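(* Consider the parametric mixed-integer optimal control problem described in the context, with the standing assumptions listed there, and suppose that the constraint functions $g_1^v,\ldots,g_M^v$ are independent of $\lambda$ for every $v\in V_{[t_0,t_{\mathrm f}]}$, so that the set of admissible controls $W_{[t_0,t_{\mathrm f}]}:=W_{[t_0,t_{\mathrm f}]}(\lambda)$ does not depend on $\lambda$. Let $\bar\lambda\in\Lambda$ be fixed and assume that for some bounded neighborhood $B(\bar\lambda)$ of $\bar\lambda$ and some constant $L_0$ $$|y_0(\lambda_1)-y_0(\lambda_2)|\le L_0\,|\lambda_1-\lambda_2|\quad\text{for all }\lambda_1,\lambda_2\in B(\bar\lambda).$$ Let $K=\sup_{\lambda\in B(\bar\lambda)}|y_0(\lambda)|$ and assume that for some constant $L_\varphi$ $$|\varphi(\lambda_1,y,u,v)-\varphi(\lambda_2,\bar y,u,v)|\le L_\varphi\,(|y-\bar y|+|\lambda_1-\lambda_2|)$$ for all $(u,v)\in W_{[t_0,t_{\mathrm f}]}$, all $y,\bar y\in C([t_0,t_{\mathrm f}];Y)$ with $\max\{|y|,|\bar y|\}\le C(t_{\mathrm f})(1+K)$ and all $\lambda_1,\lambda_2\in B(\bar\lambda)$, where $C(\cdot)$ is the function defined in the context. Then there exists a constant $\hat L_\nu$ such that $$|\nu(\lambda_1)-\nu(\lambda_2)|\le \hat L_\nu\,|\lambda_1-\lambda_2|\quad\text{for all }\lambda_1,\lambda_2\in B(\bar\lambda).$$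
   Context: Setting. $Y$ and $\Lambda$ are Banach spaces, $U$ is a complete metric space, $\mathcal V$ is a finite set (identified with $\{0,1,\ldots,N-1\}$), $[t_0,t_{\mathrm f}]$ with $t_0<t_{\mathrm f}$ is a finite time horizon, and $f\colon[t_0,t_{\mathrm f}]\times Y\times U\times\mathcal V\to Y$. $A\colon D(A)\to Y$ generates a strongly continuous semigroup $\{T(t)\}_{t\ge0}$ of bounded linear operators on $Y$. Measurability is with respect to Lebesgue measure. $U_{[t_0,t_{\mathrm f}]}$ is a Banach space of measurable functions $u\colon[t_0,t_{\mathrm f}]\to U$, and $V_{[t_0,t_{\mathrm f}]}=L^\infty(t_0,t_{\mathrm f};\mathcal V)$ is the set of measurable functions $v\colon[t_0,t_{\mathrm f}]\to\mathcal V$. $|\cdot|$ denotes the norm of the respective space; on $C([t_0,t_{\mathrm f}];Y)$ it is the supremum norm. The initial state is given by a map $\lambda\mapsto y_0(\lambda)$ from $\Lambda$ to $Y$. $M$ is a nonnegative integer ($M=0$ meaning no constraints), and for every $v\in V_{[t_0,t_{\mathrm f}]}$ functions $g_1^v,\ldots,g_M^v\colon\Lambda\times U_{[t_0,t_{\mathrm f}]}\times[t_0,t_{\mathrm f}]\to\mathbb R$ are given. The set of admissible controls is $$W_{[t_0,t_{\mathrm f}]}(\lambda)=\{(u,v)\in U_{[t_0,t_{\mathrm f}]}\times V_{[t_0,t_{\mathrm f}]}: g_k^v(\lambda,u,t)\le0,\ k=1,\ldots,M,\ t\in[t_0,t_{\mathrm f}]\}.$$ The differential equation $\dot y(t)=Ay(t)+f(t,y(t),u(t),v(t))$,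 $y(t_0)=y_0(\lambda)$, is understood in the mild sense: $y\in C([t_0,t_{\mathrm f}];Y)$ and $$y(t)=T(t-t_0)y_0(\lambda)+\int_{t_0}^tT(t-s)f(s,y(s),u(s),v(s))\,ds,\quad t\in[t_0,t_{\mathrm f}].$$ The solution is denoted $y(\cdot;y_0(\lambda),u,v)$. Optimal value. With a cost function $\varphi$ the optimal value $\nu(\lambda)\in\mathbb R\cup\{\pm\infty\}$ is $$\nu(\lambda)=\inf\{\varphi(\lambda,y,u,v): (u,v)\in W_{[t_0,t_{\mathrm f}]}(\lambda),\ y=y(\cdot;y_0(\lambda),u,v)\}.$$ Standing assumptions. 1. For each $v\in\mathcal V$ the map $f\colon[t_0,t_{\mathrm f}]\times Y\times U\times\{v\}\to Y$ is continuous, and there is $k\in L^1(t_0,t_{\mathrm f})$ such that for all admissible $(u,v)$, all $y_1,y_2\in Y$ and almost every $t\in(t_0,t_{\mathrm f})$: (i) $|f(t,y_1,u(t),v(t))-f(t,y_2,u(t),v(t))|\le k(t)|y_1-y_2|$; (ii) $|f(t,0,u(t),v(t))|\le k(t)$. 2. $\varphi\colon\Lambda\times C([t_0,t_{\mathrm f}];Y)\times U_{[t_0,t_{\mathrm f}]}\times V_{[t_0,t_{\mathrm f}]}\to\mathbb R$ is continuous, and $W_{[t_0,t_{\mathrm f}]}(\lambda)\neq\emptyset$ for all $\lambda\in\Lambda$. The function $C(t)$. $C(t)=\gamma\exp\bigl(w_0(t-t_0)+\gamma\int_{t_0}^tk(s)\,ds\bigr)$, where $\gamma\ge0$ and $w_0\ge0$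 are fixed constants (which exist under Assumption 1) such that for all $t\in[t_0,t_{\mathrm f}]$: $\|T(t)\|\le\gamma\exp(w_0(t-t_0))$, and for all $\lambda_1,\lambda_2\in\Lambda$ and admissible $(u,v)$ the solutions $y_i=y(\cdot;y_0(\lambda_i),u,v)$ satisfy $|y_i(t)|\le C(t)(1+|y_0(\lambda_i)|)$ for $i=1,2$ and $|y_1(t)-y_2(t)|\le C(t)|y_0(\lambda_1)-y_0(\lambda_2)|$. *)

(* Defs.v *)
From HB Require Import structures.
From mathcomp Require Import all_boot all_order all_algebra.
From mathcomp Require Import all_classical all_reals all_analysis.

Set Implicit Arguments.
Unset Strict Implicit.
Unset Printing Implicit Defensive.

Import Order.TTheory GRing.Theory Num.Theory.
Import numFieldNormedType.Exports.

Local Open Scope classical_set_scope.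
Local Open Scope ring_scope.

#[short(type="completeMetricType")]
HB.structure Definition CompleteMetric (R : numDomainType) :=
  {U of Metric R U & Complete U}.

(* The library's [lebesgue_measure] lives on the Borel sigma-algebra; Lebesgue
   measurability refers to its completion. *)
Notation leb R := (@completed_lebesgue_measure R).
Definition lebesgue_measurable (R : realType) (A : set R) : Prop :=
  @measurable _ (caratheodory_type ((wlength (@idfun R))^*)%mu) A.

(* A list [:: (A_1, c_1); ...; (A_m, c_m)] encodes the simple function
   \1_(A_1) c_1 + ... + \1_(A_m) c_m. *)
Definition simple_fun d (T : measurableType d) (R : realType)
    (Y : normedModType R) (s : seq (set T * Y)) (x : T) : Y :=
  \sum_(a <- s) (\1_(a.1) x : R) *: a.2.

Definition simple_integral d (T : measurableType d) (R : realType)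
    (Y : normedModType R) (mu : {measure set T -> \bar R}) (D : set T)
    (s : seq (set T * Y)) : Y :=
  \sum_(a <- s) fine (mu (D `&` a.1)) *: a.2.

(* [h] is Bochner integrable on [D] with integral [I].  For complete [mu] and
   measurable [D] the a.e. convergence makes [`|h x - simple_fun (s n) x|]
   measurable on [D], so that the real integral below is a genuine one. *)
Definition is_bochner_integral d (T : measurableType d) (R : realType)
    (Y : normedModType R) (mu : {measure set T -> \bar R}) (D : set T)
    (h : T -> Y) (I : Y) : Prop :=
  exists s : nat -> seq (set T * Y),
  [/\ forall n, {in s n, forall a, measurable a.1 /\ (mu a.1 < +oo)%E},
      {ae mu, forall x, D x -> simple_fun (s n) x @[n --> \oo] --> h x},
      (\int[mu]_(x in D) `|h x - simple_fun (s n) x|%:E)%E @[n --> \oo] --> 0%E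
    & simple_integral mu D (s n) @[n --> \oo] --> I].

Definition C0_semigroup (R : realType) (Y : normedModType R)
    (T : R -> Y -> Y) : Prop :=
  [/\ forall t, 0 <= t -> linear (T t) /\ continuous (T t),
      forall y, T 0 y = y,
      forall s t y, 0 <= s -> 0 <= t -> T (s + t) y = T s (T t y)
    & forall y, T t y @[t --> 0^'+] --> y].

(* [A], with domain [DA], is the infinitesimal generator of [T]. *)
Definition is_generator (R : realType) (Y : normedModType R)
    (DA : set Y) (A : Y -> Y) (T : R -> Y -> Y) : Prop :=
  forall y z,
    DA y /\ A y = z <-> h^-1 *: (T h y - y) @[h --> 0^'+] --> z.

Definition operator_norm (R : realType) (Y : normedModType R)
    (B : Y -> Y) : R :=
  sup [set `|B y| | y in [set y : Y | `|y| <= 1]].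

(* The spaces C([t0,tf];Y) and L^oo(t0,tf;{0,...,N-1}).  Elements are carried by
   functions on the whole line whose values outside [t0,tf] are immaterial:
   [sup_norm] and [Linf_dist] do not see them. *)
Record contfun (R : realType) (t0 tf : R) (Y : normedModType R) := ContFun {
  contfun_fun :> R -> Y ;
  contfunP : {within `[t0, tf], continuous contfun_fun} }.

HB.instance Definition _ (R : realType) (t0 tf : R) (Y : normedModType R) :=
  gen_eqMixin (contfun t0 tf Y).
HB.instance Definition _ (R : realType) (t0 tf : R) (Y : normedModType R) :=
  gen_choiceMixin (contfun t0 tf Y).

Definition contfun0 (R : realType) (t0 tf : R) (Y : normedModType R) :
    contfun t0 tf Y :=
  ContFun (continuous_subspaceT (A := `[t0, tf]) (@cst_continuous R Y 0)).

Definition sup_norm (R : realType) (t0 tf : R) (Y : normedModType R)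
    (y : R -> Y) : R :=
  sup [set `|y t| | t in `[t0, tf]].

Record switching (R : realType) (t0 tf : R) (N : nat) := Switching {
  switching_fun :> R -> 'I_N ;
  switchingP : forall i,
    lebesgue_measurable (`[t0, tf] `&` switching_fun @^-1` [set i]) }.

Definition Linf_dist (R : realType) (t0 tf : R) (N : nat)
    (v v' : switching t0 tf N) : \bar R :=
  Lnorm (leb R) +oo%E
    (fun t : R => (\1_(`[t0, tf]) t * ((v t)%:R - (v' t)%:R))%:E).

(* [UU], read through the evaluation [ev], is a space of measurable functions
   from [t0,tf] to [U]; its elements may stand for a.e.-classes, [ev] then
   being a choice of representatives. *)
Definition measurable_function_space (R : realType) (t0 tf : R)
    (U : metricType R) (UU : Type) (ev : UU -> R -> U) : Prop :=
  (forall u (O : set U), open O ->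
     lebesgue_measurable (`[t0, tf] `&` ev u @^-1` O)) /\
  (forall u u', (forall t, t \in `[t0, tf] -> ev u t = ev u' t) -> u = u').

Section control_problem.
Context (R : realType) (t0 tf : R) (Y Lam UU : completeNormedModType R)
  (U : completeMetricType R) (N M : nat) (ev : UU -> R -> U).
Local Notation VV := (switching t0 tf N).
Local Notation CC := (contfun t0 tf Y).

Definition mild_solution (T : R -> Y -> Y) (f : R -> Y -> U -> 'I_N -> Y)
    (yi : Y) (u : UU) (v : VV) (y : CC) : Prop :=
  forall t, t \in `[t0, tf] -> exists2 I : Y,
    is_bochner_integral (leb R) `[t0, t]
      (fun s => T (t - s) (f s (y s) (ev u s) (v s))) I
    & y t = T (t - t0) yi + I.

(* y(.; yi, u, v), the mild solution with initial value [yi].  The default 0 is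
   irrelevant whenever the problem is well posed. *)
Definition solution (T : R -> Y -> Y) (f : R -> Y -> U -> 'I_N -> Y)
    (yi : Y) (u : UU) (v : VV) : CC :=
  xget (contfun0 t0 tf Y) [set y | mild_solution T f yi u v y].

Definition admissible (g : VV -> 'I_M -> Lam -> UU -> R -> R) (l : Lam) :
    set (UU * VV) :=
  [set uv | forall k t, t \in `[t0, tf] -> g uv.2 k l uv.1 t <= 0].

Definition cost_continuous (phi : Lam -> CC -> UU -> VV -> R) : Prop :=
  forall (l : Lam) (y : CC) (u : UU) (v : VV) (e : R), 0 < e -> exists2 d : R, 0 < d &
  forall (l' : Lam) (y' : CC) (u' : UU) (v' : VV), 
    `|l' - l| < d -> sup_norm t0 tf (y' \- y) < d -> `|u' - u| < d ->
    (Linf_dist v' v < d%:E)%E ->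
    `|phi l' y' u' v' - phi l y u v| < e.

Definition optimal_value (T : R -> Y -> Y) (f : R -> Y -> U -> 'I_N -> Y)
    (y0 : Lam -> Y) (g : VV -> 'I_M -> Lam -> UU -> R -> R)
    (phi : Lam -> CC -> UU -> VV -> R) (l : Lam) : \bar R :=
  ereal_inf [set (phi l (solution T f (y0 l) uv.1 uv.2) uv.1 uv.2)%:E
            | uv in admissible g l].

End control_problem.

Definition growth_bound (R : realType) (t0 gamma w0 : R) (k : R -> R)
    (t : R) : R :=
  gamma * expR (w0 * (t - t0) + gamma * \int[leb R]_(s in `[t0, t]) k s).

(* |a - b| on the extended reals, with |(+oo) - (+oo)| = |(-oo) - (-oo)| = 0
   (the library's subtraction gives -oo in these two cases). *)
Definition ereal_absdiff (R : realType) (a b : \bar R) : \bar R :=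
  if a == b then 0%E else `|a - b|%E.

(* Main.v *)
(* All solutions starting from y0 l with l in B lie in the ball of radius
   C(tf) (1 + K), where phi is Lipschitz, and they depend on l in a Lipschitz
   way with constant C(tf) L0.  Hence l |-> phi(l, y(.; y0 l, u, v), u, v) is
   Lipschitz on B with the constant |Lphi| (C(tf) |L0| + 1), which does not
   depend on the control (u, v), and so is the infimum over the common set of
   admissible controls. *)
Require Import Defs.
From mathcomp Require Import all_boot all_order all_algebra.
From mathcomp Require Import all_classical all_reals all_analysis.
From mathcomp Require Import measurable_realfun.
Import Order.TTheory GRing.Theory Num.Theory.
Import numFieldNormedType.Exports.
Local Open Scope classical_set_scope.
Local Open Scope ring_scope.

(** The integral over [D] is the one over [A] plus the one over the difference, where [k] agrees
    a.e. with its absolute value. The null set [N] leaves room for points, such as the ends of an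
    interval, where the sign of [k] is unknown. *)
Lemma ae_ge0_subset_Rintegral d (T : measurableType d) (R : realType)
    (mu : {measure set T -> \bar R}) (A D N : set T) (k : T -> R) :
  measurable A -> measurable D -> A `<=` D -> measurable N -> mu N = 0%E ->
  mu.-integrable D (EFin \o k) ->
  {ae mu, forall x, (D `\` N) x -> 0 <= k x} ->
  \int[mu]_(x in A) k x <= \int[mu]_(x in D) k x.
Proof.
move=> mA mD AD mN N0 kD k0.
have mDA : measurable (D `\` A) by exact: measurableD.
have kDA : mu.-integrable (D `\` A) (EFin \o k).
  by apply: integrableS kD => //; exact: subDsetl.
have DE : D = A `|` (D `\` A) by rewrite setDUK.
rewrite [in leRHS]DE Rintegral_setU //; last 2 first.
- by rewrite -DE.
- by rewrite disj_set2E setDIK.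
rewrite lerDl (_ : \int[mu]_(x in D `\` A) k x =
    \int[mu]_(x in D `\` A) `|k x|) ?Rintegral_ge0 //.
have mk : measurable_fun (D `\` A) k.
  exact/measurable_EFinP/(measurable_int mu).
congr fine; apply: ae_eq_integral => //.
- exact/measurable_EFinP.
- exact/measurable_EFinP/measurableT_comp.
- have NN : \forall x \ae mu, ~ N x by exists N; split => // x /notP.
  by apply: filterS2 k0 NN => x k0 Nx [Dx _]; rewrite ger0_norm // k0.
Qed.

Section completed_lebesgue.
Context (R : realType).
Local Notation cara := (caratheodory_type ((wlength (@idfun R))^*)%mu).

Lemma completed_lebesgue_measurable (A : set R) :
  measurable A -> @measurable _ cara A.
Proof. exact: sub_caratheodory. Qed.

Lemma completed_lebesgue_set1 (x : R) : leb R [set x] = 0%E.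
Proof. exact: lebesgue_measure_set1. Qed.

(** The hypotheses on [k] live on the open interval, the integrals on closed ones; the two endpoints
    serve as the exceptional null set. *)
Lemma Rintegral_itv_mono (a b t : R) (k : R -> R) :
  (leb R).-integrable `]a, b[ (EFin \o k) ->
  {ae leb R, forall x, x \in `]a, b[ -> 0 <= k x} ->
  t \in `[a, b] ->
  \int[leb R]_(x in `[a, t]) k x <= \int[leb R]_(x in `[a, b]) k x.
Proof.
move=> ki k0; rewrite in_itv /= => /andP[_ tb].
have m1 (x : R) : @measurable _ cara [set x].
  exact: completed_lebesgue_measurable.
have mitv (i : interval R) : @measurable _ cara [set` i].
  exact: completed_lebesgue_measurable.
have mN : @measurable _ cara ([set a] `|` [set b]) by exact: measurableU.
have N0 : leb R ([set a] `|` [set b]) = 0%E.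
  by rewrite measureU0 //; exact: completed_lebesgue_set1.
have bE : `[a, b]%classic `\` ([set a] `|` [set b]) = `]a, b[%classic :> set R.
  apply/seteqP; split=> x /=; rewrite !in_itv /=.
    move=> [/andP[ax xb] /not_orP[/eqP xa /eqP xnb]].
    by rewrite !lt_neqAle ax xb xnb eq_sym xa.
  move=> /andP[ax xb]; split; first by rewrite !ltW.
  by case=> xE; move: ax xb; rewrite xE ltxx.
apply: (@ae_ge0_subset_Rintegral _ cara R (leb R) _ _ ([set a] `|` [set b])) => //.
- by move=> x /=; rewrite !in_itv /= => /andP[-> /le_trans->].
- apply/(negligible_integrable mN (mitv _) _ N0); last by rewrite bE.
  (* Measurability of [k] extends to the endpoints because every function is measurable on a
     singleton. *)
  have abU : `[a, b]%classic `<=` `]a, b[ `|` ([set a] `|` [set b]).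
    by rewrite -bE => x abx; case: (pselect (([set a] `|` [set b]) x));
      [right|left].
  apply: (@measurable_funS _ _ cara _
    (`]a, b[%classic `|` ([set a] `|` [set b]))) => //.
    exact: measurableU.
  apply/measurable_funU => //; split; first exact: (measurable_int (leb R)).
  by apply/measurable_funU => //; split; exact: measurable_fun_set1.
- by rewrite bE.
Qed.

End completed_lebesgue.

Lemma growth_bound_ge0 (R : realType) (t0 gamma w0 : R) (k : R -> R) (t : R) :
  0 <= gamma -> 0 <= growth_bound t0 gamma w0 k t.
Proof. by move=> g0; rewrite mulr_ge0 // expR_ge0. Qed.

(** Both terms of the exponent grow with [t], so pointwise bounds in $C(t)$ become sup-norm bounds
    in $C(t_f)$. *)
Lemma le_growth_bound (R : realType) (t0 tf gamma w0 : R) (k : R -> R) (t : R) :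
  0 <= gamma -> 0 <= w0 ->
  (leb R).-integrable `]t0, tf[ (EFin \o k) ->
  {ae leb R, forall x, x \in `]t0, tf[ -> 0 <= k x} ->
  t \in `[t0, tf] ->
  growth_bound t0 gamma w0 k t <= growth_bound t0 gamma w0 k tf.
Proof.
move=> g0 w00 ki k0 tI.
rewrite ler_wpM2l // ler_expR lerD ?ler_wpM2l ?lerB //.
  by move: tI; rewrite in_itv => /andP[].
exact: Rintegral_itv_mono.
Qed.

Lemma sup_norm_le (R : realType) (t0 tf : R) (Y : normedModType R)
    (y : R -> Y) (c : R) : t0 <= tf ->
  (forall t, t \in `[t0, tf] -> `|y t| <= c) -> sup_norm t0 tf y <= c.
Proof.
move=> t0tf yc; apply: ge_sup => [|_ [t tI <-]]; last exact: yc.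
by exists `|y t0|, t0 => //=; rewrite in_itv /= lexx.
Qed.

Lemma sup_norm_ge0 (R : realType) (t0 tf : R) (Y : normedModType R)
    (y : R -> Y) : 0 <= sup_norm t0 tf y.
Proof.
(* When the norms have no supremum, [sup] takes its default value 0. *)
have [yS|/sup_out] := pselect (has_sup [set `|y t| | t in `[t0, tf]]).
  have [[r yr] _] := yS; apply: le_trans (sup_upper_bound yS yr).
  by case: yr => t _ <-.
by rewrite /sup_norm => ->.
Qed.

(** A bound [f i <= h i + c] uniform in [i] passes to the infima; it is applied in both
    directions. *)
Lemma ereal_absdiff_inf_le (R : realType) (I : Type) (W : set I)
    (F G : I -> R) (c : R) :
  W !=set0 -> 0 <= c -> (forall i, W i -> `|F i - G i| <= c) ->
  (ereal_absdiff (ereal_inf [set (F i)%:E | i in W])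
                 (ereal_inf [set (G i)%:E | i in W]) <= c%:E)%E.
Proof.
move=> W0 c0 FG.
have infle (f h : I -> R) : (forall i, W i -> f i <= h i + c) ->
    (ereal_inf [set (f i)%:E | i in W] - c%:E
       <= ereal_inf [set (h i)%:E | i in W])%E.
  move=> fh; apply: le_ereal_inf_tmp => _ [i Wi <-].
  rewrite leeBlDr //; apply: ge_ereal_inf; exists (f i)%:E; first by exists i.
  by rewrite -EFinD lee_fin fh.
have ltoo (f : I -> R) : (ereal_inf [set (f i)%:E | i in W] < +oo)%E.
  have [i Wi] := W0; apply: le_lt_trans (ltry (f i)).
  by apply: ereal_inf_lbound; exists i.
have leF : (ereal_inf [set (F i)%:E | i in W] - c%:E
    <= ereal_inf [set (G i)%:E | i in W])%E.
  by apply: infle => i /FG/ler_distlDr.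
have leG : (ereal_inf [set (G i)%:E | i in W] - c%:E
    <= ereal_inf [set (F i)%:E | i in W])%E.
  by apply: infle => i /FG; rewrite distrC => /ler_distlDr.
move: leF leG (ltoo F) (ltoo G); rewrite /ereal_absdiff.
move: (ereal_inf _) (ereal_inf _) => a b; case: eqP => //.
(* Only two finite infima remain: +oo is excluded since [W] is nonempty, and if one infimum is -oo,
   [leF] or [leG] forces the other to be -oo as well, the case of equality settled before. *)
move: a b => [a| |] [b| |] // _; rewrite -!EFinB !lee_fin lerBlDr => leF leG.
by rewrite ler_distl leG leF.
Qed.

Theorem theorem1
  (R : realType) (t0 tf : R) (t0tf : t0 < tf)
  (Y Lam UU : completeNormedModType R) (U : completeMetricType R) (N M : nat)
  (* the Banach space UU of measurable controls *)
  (ev : UU -> R -> U) (UUP : measurable_function_space t0 tf ev)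
  (* dynamics *)
  (T : R -> Y -> Y) (TP : C0_semigroup T)
  (DA : set Y) (A : Y -> Y) (AP : is_generator DA A T)
  (f : R -> Y -> U -> 'I_N -> Y) (y0 : Lam -> Y)
  (* constraints and cost *)
  (g : switching t0 tf N -> 'I_M -> Lam -> UU -> R -> R)
  (phi : Lam -> contfun t0 tf Y -> UU -> switching t0 tf N -> R)
  (* standing assumptions on f *)
  (fC : forall i : 'I_N,
     {within [set p : R * Y * U | p.1.1 \in `[t0, tf]],
       continuous (fun p => f p.1.1 p.1.2 p.2 i)})
  (k : R -> R) (kL1 : (leb R).-integrable `]t0, tf[ (EFin \o k))
  (f_lip : forall l u v, admissible g l (u, v) -> forall y1 y2 : Y,
     {ae leb R, forall t, t \in `]t0, tf[ ->
       `|f t y1 (ev u t) (v t) - f t y2 (ev u t) (v t)| <= k t * `|y1 - y2|})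
  (f_bnd : forall l u v, admissible g l (u, v) ->
     {ae leb R, forall t, t \in `]t0, tf[ ->
       `|f t 0 (ev u t) (v t)| <= k t})
  (* standing assumptions on the cost and the admissible set *)
  (phiC : cost_continuous phi)
  (W_neq0 : forall l, admissible g l !=set0)
  (* the constants of C(t) *)
  (gamma w0 : R) (gamma_ge0 : 0 <= gamma) (w0_ge0 : 0 <= w0)
  (T_bnd : forall t, t \in `[t0, tf] -> 0 <= t ->
     operator_norm (T t) <= gamma * expR (w0 * (t - t0)))
  (sol_bnd : forall l u v, admissible g l (u, v) ->
     forall l1 t, t \in `[t0, tf] ->
     `|solution ev T f (y0 l1) u v t|
       <= growth_bound t0 gamma w0 k t * (1 + `|y0 l1|))
  (sol_lip : forall l u v, admissible g l (u, v) ->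
     forall l1 l2 t, t \in `[t0, tf] ->
     `|solution ev T f (y0 l1) u v t - solution ev T f (y0 l2) u v t|
       <= growth_bound t0 gamma w0 k t * `|y0 l1 - y0 l2|)
  (* hypotheses of the theorem *)
  (g_indep : forall v i l1 l2 u t, t \in `[t0, tf] ->
     g v i l1 u t = g v i l2 u t)
  (lbar : Lam) (B : set Lam) (B_nbhs : nbhs lbar B) (B_bounded : bounded_set B)
  (L0 : R)
  (y0_lip : forall l1 l2, B l1 -> B l2 -> `|y0 l1 - y0 l2| <= L0 * `|l1 - l2|)
  (Lphi : R)
  (phi_lip : let K := sup [set `|y0 l| | l in B] in
     forall l u v, admissible g l (u, v) ->
     forall y ybar : contfun t0 tf Y,
     Num.max (sup_norm t0 tf y) (sup_norm t0 tf ybar)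
       <= growth_bound t0 gamma w0 k tf * (1 + K) ->
     forall l1 l2, B l1 -> B l2 ->
     `|phi l1 y u v - phi l2 ybar u v|
       <= Lphi * (sup_norm t0 tf (y \- ybar) + `|l1 - l2|)) :
  exists Lnu : R, forall l1 l2, B l1 -> B l2 ->
    (ereal_absdiff (optimal_value ev T f y0 g phi l1)
                   (optimal_value ev T f y0 g phi l2)
       <= (Lnu * `|l1 - l2|)%:E)%E.
Proof.
have sW l l' : admissible g l `<=` admissible g l'.
  by move=> uv adm i t tI; rewrite (g_indep _ _ l' l _ _ tI); exact: adm.
have WE l l' : admissible g l = admissible g l' by apply/seteqP; split.
have t0tf' : t0 <= tf by exact: ltW.
have tfI : tf \in `[t0, tf] by rewrite in_itv /= t0tf' lexx.
(* The sign of [k] comes from [f_bnd] for any one admissible control, as [k] dominates a norm. *)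
have k0 : {ae leb R, forall t, t \in `]t0, tf[ -> 0 <= k t}.
  have [[u v] adm] := W_neq0 lbar.
  apply: (@filterS _ _ (ae_filter_ringOfSetsType (leb R)) _ _ _
    (f_bnd _ _ _ adm)) => t ft tI.
  exact: le_trans (ft tI).
pose G := growth_bound t0 gamma w0 k tf.
have G0 : 0 <= G by exact: growth_bound_ge0.
have GP t : t \in `[t0, tf] -> growth_bound t0 gamma w0 k t <= G.
  exact: le_growth_bound.
pose K := sup [set `|y0 l| | l in B].
have Blbar : B lbar by exact: nbhs_singleton.
have y0K l : B l -> `|y0 l| <= K.
  move=> Bl; apply: ub_le_sup; last by exists l.
  have [m [_ mB]] := B_bounded.
  (* Comparing [y0 l'] with [y0 lbar] shows that the set defining [K] is bounded above; [m + 1] is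
     there because [bounded_set] only gives bounds strictly above [m]. *)
  exists (`|L0| * ((m + 1) + `|lbar|) + `|y0 lbar|) => _ [l' Bl' <-].
  rewrite -lerBlDr (le_trans (lerB_dist _ _)) //.
  rewrite (le_trans (y0_lip _ _ Bl' Blbar)) //.
  rewrite (le_trans (ler_wpM2r _ (ler_norm _))) // ler_wpM2l //.
  rewrite (le_trans (ler_normB _ _)) // lerD2r.
  by apply: mB Bl'; rewrite ltrDl.
(* The absolute values make the constant nonnegative, since [Lphi] and [L0] may have any sign. *)
exists (`|Lphi| * (G * `|L0| + 1)) => l1 l2 Bl1 Bl2.
have sol_sup l u v : admissible g l1 (u, v) -> B l ->
    sup_norm t0 tf (solution ev T f (y0 l) u v) <= G * (1 + K).
  move=> adm Bl; apply: sup_norm_le => // t tI.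
  rewrite (le_trans (sol_bnd _ _ _ adm _ _ tI)) //.
  rewrite ler_pM ?growth_bound_ge0 ?GP //.
  by rewrite lerD2l y0K.
(* Both infima now range over the same controls, so it suffices to compare costs for one fixed
   control. *)
rewrite /optimal_value (WE l2 l1); apply: ereal_absdiff_inf_le => //.
  by rewrite !mulr_ge0 // addr_ge0 // mulr_ge0.
move=> [u v] adm /=.
rewrite (le_trans (phi_lip _ _ _ adm _ _ _ _ _ Bl1 Bl2)) //.
  by rewrite ge_max !sol_sup.
have dy : sup_norm t0 tf (solution ev T f (y0 l1) u v \-
                          solution ev T f (y0 l2) u v)
          <= G * `|L0| * `|l1 - l2|.
  apply: sup_norm_le => // t tI /=.
  rewrite (le_trans (sol_lip _ _ _ adm _ _ _ tI)) // -mulrA.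
  rewrite ler_pM ?growth_bound_ge0 ?GP //.
  by rewrite (le_trans (y0_lip _ _ Bl1 Bl2)) // ler_wpM2r // ler_norm.
rewrite -mulrA (le_trans (ler_wpM2r _ (ler_norm Lphi))) ?addr_ge0 ?sup_norm_ge0 //.
by rewrite ler_wpM2l // mulrDl mul1r lerD2r.
Qed.
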